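(* Let $N$ be a positive integer. For any set $S\subseteq[N]$, there exists a super edge, denoted $\mathsf{DenseLoad}_S$, loading $S$, with the following complexities for any input $z\in\{0,1\}^N$: $$c^0(\mathsf{DenseLoad}_S,z)=|S|^2\quad\text{and}\quad c^1(\mathsf{DenseLoad}_S,z)=1.$$
   Context: For $S\subseteq[N]$, $z_S$ is the restriction of $z\in\{0,1\}^N$ to the positions in $S$. Let $Y\subseteq Z\subseteq\{0,1\}^N$ ($Z$ is the set of inputs, $Y$ the set of positive inputs). An extended learning graph is a tuple $(\mathcal V,\mathcal E,\mathcal S,\{w_z^b:z\in Z,b\in\{0,1\}\},\{p_y:y\in Y\})$ such that: (i) $(\mathcal V,\mathcal E)$ is a directed acyclic graph rooted in some vertex $r\in\mathcal V$; (ii) $\mathcal S$ maps each $v\in\mathcal V$ to a set $\mathcal S(v)\subseteq[N]$, with $\mathcal S(r)=\emptyset$ and, for every $(u,v)\in\mathcal E$, $\mathcal S(v)=\mathcal S(u)\cup\{j\}$ for some $j\notin\mathcal S(u)$; (iii) the values $w_z^b(u,v)$ are in $\mathbb R_{\ge0}$ and depend on $z$ only through $z_{\mathcal S(v)}$, for every $(u,v)\in\mathcal E$; (iv) $w_x^0(u,v)=w_y^1(u,v)$ for all $x\in Z\setminus Y$, $y\in Y$ and $(u,v)\in\mathcal E$ such that $x_{\mathcal S(u)}=y_{\mathcal S(u)}$ and $x_j\ne y_j$, where $\mathcal S(v)=\mathcal S(u)\cup\{j\}$; (v) for every $y\in Y$, $p_y:\mathcal E\to\mathbb R_{\ge0}$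 is a unit flow whose source is the root and such that $p_y(e)=0$ when $w_y^1(e)=0$. A super edge is an extended learning graph such that each possible flow has the same unique sink; it loads $S$ when this sink is labelled by $S$. Its negative and positive edge-complexities are $c^0(\cdot,x)=\sum_{e\in\mathcal E}w_x^0(e)$ on $x\in Z\setminus Y$ and $c^1(\cdot,y)=\sum_{e\in\mathcal E}p_y(e)^2/w_y^1(e)$ on $y\in Y$. In the claim the weights and the flow are given for every $z\in\{0,1\}^N$, and both formulas are evaluated at any $z$.
   Formalization: The set S is assumed nonempty: for S = ∅ the sink would have to be the root, so no flow passes any edge and c^1 would be an empty sum 0 rather than 1, which makes the claim false in that case. *)

(* Defs.v *)
From HB Require Import structures.
From mathcomp Require Import all_boot all_order all_algebra.
From mathcomp Require Import reals.

Set Implicit Arguments.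
Unset Strict Implicit.
Unset Printing Implicit Defensive.

Import Order.TTheory GRing.Theory Num.Theory.
Local Open Scope ring_scope.

Notation input N := {ffun 'I_N -> bool}.

(* The raw data (V, E, S, w, p) together with the root, without any axiom.
   Weights and flows are given for every z in {0,1}^N; [lg_w z b] is w_z^b,
   with b = false for 0 and b = true for 1.  [lg_w] and [lg_p] are functions on
   V * V, but only their values on [lg_edges] are ever used. *)
Record lgraph (R : realType) (N : nat) := LGraph {
  lg_vertex : finType;
  lg_edges : {set lg_vertex * lg_vertex};
  lg_root : lg_vertex;
  lg_label : lg_vertex -> {set 'I_N};
  lg_w : input N -> bool -> lg_vertex * lg_vertex -> R;
  lg_p : input N -> lg_vertex * lg_vertex -> R
}.

Arguments lg_w {R N} G z b e : rename.
Arguments lg_p {R N} G z e : rename.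

Section LearningGraph.
Variables (R : realType) (N : nat).
Implicit Types (Y Z : {set input N}) (S : {set 'I_N}) (G : lgraph R N).

Definition edge_rel G : rel (lg_vertex G) := [rel u v | (u, v) \in lg_edges G].
Arguments edge_rel : clear implicits.

Definition rooted_dag G : Prop :=
  (forall s : seq (lg_vertex G), cycle (edge_rel G) s -> s = [::]) /\
  (forall v, connect (edge_rel G) (lg_root G) v).

Definition labels_ok G : Prop :=
  lg_label (lg_root G) = set0 /\
  (forall u v, (u, v) \in lg_edges G ->
     exists2 j, j \notin lg_label u & lg_label v = j |: lg_label u).

Definition weights_ok Z G : Prop :=
  (forall z b e, z \in Z -> e \in lg_edges G -> 0 <= lg_w G z b e) /\
  (forall z z' b u v, z \in Z -> z' \in Z -> (u, v) \in lg_edges G ->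
     {in lg_label v, z =1 z'} ->
     lg_w G z b (u, v) = lg_w G z' b (u, v)).

Definition weights_match Y Z G : Prop :=
  forall x y u v j, x \in Z :\: Y -> y \in Y -> (u, v) \in lg_edges G ->
    lg_label v = j |: lg_label u ->
    {in lg_label u, x =1 y} -> x j != y j ->
    lg_w G x false (u, v) = lg_w G y true (u, v).

Definition inflow G (f : lg_vertex G * lg_vertex G -> R) (v : lg_vertex G) : R :=
  \sum_(u | (u, v) \in lg_edges G) f (u, v).

Definition outflow G (f : lg_vertex G * lg_vertex G -> R) (v : lg_vertex G) : R :=
  \sum_(u | (v, u) \in lg_edges G) f (v, u).

(* One unit leaves the root, and no other vertex creates flow; the vertices that
   absorb some flow are the sinks. *)
Definition unit_flow G (f : lg_vertex G * lg_vertex G -> R) : Prop :=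
  [/\ forall e, e \in lg_edges G -> 0 <= f e,
      outflow f (lg_root G) - inflow f (lg_root G) = 1
    & forall v, v != lg_root G -> outflow f v <= inflow f v].

Definition is_sink G (f : lg_vertex G * lg_vertex G -> R) (v : lg_vertex G) : Prop :=
  outflow f v < inflow f v.

Definition flows_ok Y G : Prop :=
  forall y, y \in Y ->
    unit_flow (lg_p G y) /\
    (forall e, e \in lg_edges G ->
       lg_w G y true e = 0 -> lg_p G y e = 0).

Definition extended_learning_graph Y Z G : Prop :=
  [/\ rooted_dag G, labels_ok G, weights_ok Z G, weights_match Y Z G
    & flows_ok Y G].

Definition common_sink Y G (t : lg_vertex G) : Prop :=
  forall y, y \in Y -> forall v, is_sink (lg_p G y) v <-> v = t.
Arguments common_sink : clear implicits.

Definition super_edge Y Z G : Prop :=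
  extended_learning_graph Y Z G /\ exists t, common_sink Y G t.

Definition loads Y G S : Prop :=
  exists2 t, common_sink Y G t & lg_label t = S.

Definition c0 G (z : input N) : R :=
  \sum_(e in lg_edges G) lg_w G z false e.

(* By flows_ok, the terms with w_z^1(e) = 0 are 0 / 0, which is 0 here. *)
Definition c1 G (z : input N) : R :=
  \sum_(e in lg_edges G) lg_p G z e ^+ 2 / lg_w G z true e.

End LearningGraph.

(* Main.v *)
Require Import Defs.
From mathcomp Require Import all_boot all_order all_algebra.
From mathcomp Require Import reals.

Set Implicit Arguments.
Unset Strict Implicit.
Unset Printing Implicit Defensive.

Import Order.TTheory GRing.Theory Num.Theory.
Local Open Scope ring_scope.

(** Take the path with [k = #|S|] edges that loads the elements of [S] one by
    one, put the constant weight [k] on every edge and send the whole unit of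
    flow along it. Then [c0 = k * k] and [c1 = k * (1 / k)]. *)

(** The edges are the image of ['I_k] under [i] to [(i, i + 1)], so injectivity alone counts
    them. *)
Definition path_edges (k : nat) : {set 'I_k.+1 * 'I_k.+1} :=
  [set (widen_ord (leqnSn k) i, lift ord0 i) | i : 'I_k].

Lemma in_path_edges k (u v : 'I_k.+1) :
  ((u, v) \in path_edges k) = (v == u.+1 :> nat).
Proof.
apply/imsetP/eqP => [[i _ [-> ->]] // | vu].
have uk : (u < k)%N by rewrite -ltnS -vu.
by exists (Ordinal uk) => //; congr (_, _); apply/val_inj.
Qed.

Lemma card_path_edges k : #|path_edges k| = k.
Proof. by rewrite card_imset ?card_ord // => i j [/val_inj]. Qed.

(** The order of loading is arbitrary; that of [enum S] is taken. *)
Definition prefix_set (T : finType) (S : {set T}) (i : nat) : {set T} :=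
  [set x in take i (enum S)].

Lemma prefix_setS (T : finType) (S : {set T}) i : (i < #|S|)%N ->
  exists2 j, j \notin prefix_set S i & prefix_set S i.+1 = j |: prefix_set S i.
Proof.
rewrite cardE => ltiS.
(* [x0] only serves as the default value of [nth]; the element loaded next is the one at position
   [i]. *)
have [x0 _] : exists x, x \in S.
  by apply/card_gt0P; rewrite cardE (leq_ltn_trans _ ltiS).
exists (nth x0 (enum S) i).
  (* Split [enum S] just before position [i]: as it has no duplicates, the head of the second part
     is not in the first. *)
  have := enum_uniq S; rewrite -{1}(cat_take_drop i (enum S)) (drop_nth x0) //.
  by rewrite cat_uniq /= negb_or inE => /and3P[_ /andP[]].
by apply/setP => x; rewrite !inE (take_nth x0) // mem_rcons inE.
Qed.

Definition dense_load (R : realType) (N : nat) (S : {set 'I_N}) : lgraph R N :=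
  @LGraph R N 'I_#|S|.+1 (path_edges #|S|) ord0 (fun i => prefix_set S i)
    (fun _ _ _ => #|S|%:R) (fun _ _ => 1).

Section DenseLoad.
Variables (R : realType) (N : nat) (S : {set 'I_N}).
Local Notation G := (dense_load R S).

Lemma dense_load_edges (u v : lg_vertex G) :
  ((u, v) \in lg_edges G) = (v == u.+1 :> nat).
Proof. exact: in_path_edges. Qed.

Lemma dense_load_rooted_dag : rooted_dag G.
Proof.
split=> [[//|x s] /= cyc | v].
  (* Edges increase the index, so a cycle through [x] would be an increasing path from [x] back to
     itself, giving [x < x]. *)
  have: path (relpre val ltn) x (rcons s x).
    apply: sub_path cyc => u v; rewrite [edge_rel _ _]dense_load_edges /=.
    by move/eqP->.
  move/order_path_min => /(_ (fun _ _ _ => @ltn_trans _ _ _)) /allP/(_ x).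
  by rewrite mem_rcons mem_head /= ltnn => /(_ isT).
case: v => n; elim: n => [|n IHn] lt_n.
  by rewrite (_ : Ordinal _ = ord0) //; apply: val_inj.
apply: connect_trans (IHn (ltnW lt_n)) (connect1 _).
by rewrite [edge_rel _ _]dense_load_edges.
Qed.

Lemma dense_load_labels_ok : labels_ok G.
Proof.
split=> [|u v]; first by apply/setP => x; rewrite !inE take0.
rewrite dense_load_edges => /eqP vu /=; rewrite vu.
by apply: prefix_setS; rewrite -ltnS -vu.
Qed.

Lemma dense_load_inflow z (v : 'I_#|S|.+1) :
  inflow (G := G) (lg_p G z) v = (0 < v)%N%:R.
Proof.
rewrite /inflow (eq_bigl (fun u : 'I_#|S|.+1 => v == u.+1 :> nat)); last first.
  by move=> u; apply: dense_load_edges.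
case: (posnP v) => [v0 | v_gt0]; first by rewrite big_pred0 // => u; rewrite v0.
(* A vertex other than the root has exactly one predecessor, so its inflow is a single term equal to
   1. *)
rewrite (big_pred1 (inord v.-1)) // => u /=.
rewrite -val_eqE /= inordK; last by rewrite prednK // ltnW.
by rewrite -{1}(prednK v_gt0) eqSS eq_sym.
Qed.

Lemma dense_load_outflow z (v : 'I_#|S|.+1) :
  outflow (G := G) (lg_p G z) v = (v < #|S|)%N%:R.
Proof.
rewrite /outflow (eq_bigl (fun u : 'I_#|S|.+1 => u == v.+1 :> nat)); last first.
  by move=> u; apply: dense_load_edges.
case: ltnP => [ltvS | leSv]; last first.
  (* A successor of [v] would have index [v.+1], beyond the last vertex [#|S|]. *)
  by rewrite big_pred0 // => u; apply/ltn_eqF/(leq_trans (ltn_ord u)).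
by rewrite (big_pred1 (inord v.+1)) // => u /=; rewrite -val_eqE /= inordK.
Qed.

(** For empty [S] the path is a single vertex: no unit can leave the root, and [c1] is an empty
    sum. *)
Hypothesis S_gt0 : (0 < #|S|)%N.

Lemma dense_load_unit_flow z : unit_flow (G := G) (lg_p G z).
Proof.
split=> [e _ /= | | v]; first exact: ler01.
  by rewrite dense_load_inflow dense_load_outflow /= S_gt0 subr0.
rewrite dense_load_inflow dense_load_outflow ler_nat -val_eqE /= -lt0n => ->.
exact: leq_b1.
Qed.

(** Inflow and outflow are 0 or 1, so flow is absorbed only where something enters and nothing
    leaves: at the end of the path, which differs from the root. *)
Lemma dense_load_is_sink z v :
  is_sink (G := G) (lg_p G z) v <-> v = ord_max.
Proof.
rewrite /is_sink dense_load_inflow dense_load_outflow ltr_nat.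
split=> [|->]; last by rewrite ltnn S_gt0.
case: (ltnP v #|S|) => [_|leSv _]; first by case: (0 < v)%N.
by apply/val_inj/eqP; rewrite eqn_leq leSv -ltnS ltn_ord.
Qed.

Lemma dense_load_elg Y Z : extended_learning_graph Y Z G.
Proof.
split.
- exact: dense_load_rooted_dag.
- exact: dense_load_labels_ok.
- by split=> // *; apply: ler0n.
(* Both weights are the same constant, whatever the input and the bit. *)
- by [].
move=> y _; split; first exact: dense_load_unit_flow.
(* The weight [#|S|] is never zero, so the condition is vacuous. *)
by move=> e _ /eqP; rewrite pnatr_eq0 -leqn0 leqNgt S_gt0.
Qed.

Lemma dense_load_common_sink Y : common_sink (G := G) Y ord_max.
Proof. by move=> y _ v; apply: dense_load_is_sink. Qed.

Lemma dense_load_loads Y : loads Y G S.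
Proof.
exists ord_max; first exact: dense_load_common_sink.
(* At index [#|S|] the prefix is the whole enumeration. *)
by apply/setP => x; rewrite /= inE cardE take_size mem_enum.
Qed.

Lemma c0_dense_load z : c0 G z = #|S|%:R ^+ 2.
Proof. by rewrite /c0 sumr_const card_path_edges -[LHS]mulr_natr. Qed.

Lemma c1_dense_load z : c1 G z = 1.
Proof.
rewrite /c1 /= sumr_const card_path_edges expr1n mul1r -[LHS]mulr_natr mulVf //.
by rewrite pnatr_eq0 -lt0n.
Qed.

End DenseLoad.

Theorem lemma3p7 (R : realType) (N : nat) (hN : (0 < N)%N)
    (S : {set 'I_N}) (hS : S != set0) :
  exists G : lgraph R N,
    (forall Y Z : {set input N}, Y \subset Z ->
       super_edge Y Z G /\ loads Y G S) /\
    (forall z : input N, c0 G z = #|S|%:R ^+ 2 /\ c1 G z = 1).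
Proof.
have S_gt0 : (0 < #|S|)%N by rewrite card_gt0.
(* The graph is built from [S] alone, so one choice serves all [Y] and [Z]. *)
exists (dense_load R S); split=> [Y Z _ | z]; last first.
  by split; [exact: c0_dense_load | exact: c1_dense_load].
split; last exact: dense_load_loads.
split; first exact: dense_load_elg.
by exists ord_max; apply: dense_load_common_sink.
Qed.
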